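(* Let $m$ be a positive integer and suppose that the index set $T$ is a compact subset of $\mathbb{R}^m$. Let $T_o\subseteq\mathbb{R}^m$ be an open set that includes $T$ and let $p_{T_o}\colon\mathbb{R}\times T_o\to\mathbb{R}$ be a Borel measurable map such that $p_{T_o}(x,t)=p_t(x)$ for all $x\in\mathbb{R}$ and $t\in T$. Assume that $p_{T_o}$ is continuously differentiable in both its arguments $(x,t)$, that $\int_{\mathbb{R}}\sup_{t\in T}p_t(x)\,\mathrm{d}x<+\infty$, and that $f$ is bounded. Then the importance sampling estimator $\hat{\underline{\mathrm{E}}}_n^{\mathscr{P}/P}(f)$ is a strongly consistent estimator of $\underline{\mathrm{E}}^{\mathscr{P}}(f)$.
   Context: Setting. $\mathscr{B}$ is the Borel $\sigma$-field on $\mathbb{R}$. $T$ is a non-empty index set and $\mathscr{P}=\{P_t : t\in T\}$ is a set of probability measures on $(\mathbb{R},\mathscr{B})$, each absolutely continuous with respect to Lebesgue measure, with density $p_t$. $P$ is a (central) probability measure on $(\mathbb{R},\mathscr{B})$, not necessarily in $\mathscr{P}$, that is also absolutely continuous, with density $p$. With $\operatorname{supp}q:=\{x\in\mathbb{R}: q(x)>0\}$ for a density $q$, it is assumed that $\operatorname{supp}p\supseteq\operatorname{supp}p_t$ for all $t\in T$. For a probability measure $Q$, $\mathrm{E}^Q(h)=\int h\,\mathrm{d}Q$. The map $f\colon\mathbb{R}\to\mathbb{R}$ is Borel measurable with $\sup_{t\in T}\mathrm{E}^{P_t}(|f|)<+\infty$, and $\underline{\mathrm{E}}^{\mathscr{P}}(f):=\inf_{t\in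 T}\mathrm{E}^{P_t}(f)$. For each $t\in T$, $f_t\colon\mathbb{R}\to\mathbb{R}$ is a Borel measurable map that satisfies $f_t(x)=f(x)\,p_t(x)/p(x)$ for all $x\in\operatorname{supp}p$ (values outside $\operatorname{supp}p$, a $P$-null set, are irrelevant). Sampling. $(\mathbb{R}^\infty,\mathscr{B}^\infty,P^\infty)$ is the countably infinite product of copies of $(\mathbb{R},\mathscr{B},P)$ and $X_k\colon\mathbb{R}^\infty\to\mathbb{R}$ is the $k$-th coordinate projection. The importance sampling estimator is the (not necessarily measurable) extended real-valued map $$\hat{\underline{\mathrm{E}}}_n^{\mathscr{P}/P}(f):=\inf_{t\in T}\frac1n\sum_{k=1}^n f_t(X_k)\quad\Big(=\inf_{t\in T}\frac1n\sum_{k=1}^n f(X_k)\frac{p_t(X_k)}{p(X_k)}\ \text{ when all } X_k\in\operatorname{supp}p\Big).$$ Strong consistency. For any map $h\colon\mathbb{R}^\infty\to\overline{\mathbb{R}}:=\mathbb{R}\cup\{-\infty,+\infty\}$, $h^*$ denotes a minimal measurable cover: a measurable map $h^*\colon\mathbb{R}^\infty\to\overline{\mathbb{R}}$ with $h^*\geqslant h$ and such that every measurable $g\colon\mathbb{R}^\infty\to\overline{\mathbb{R}}$ with $g\geqslant h$ satisfies $g\geqslant h^*$ $P^\infty$-almost surely; it always exists and is unique up to $P^\infty$-null sets. The estimator is strongly consistent if $\big|\hat{\underline{\mathrm{E}}}_n^{\mathscr{P}/P}(f)-\underline{\mathrm{E}}^{\mathscr{P}}(f)\big|^*\to0$ $P^\infty$-almost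 surely as $n\to+\infty$, where $|h|^*$ is the minimal measurable cover of $|h|$. *)

(* Defs.v *)
From HB Require Import structures.
From mathcomp Require Import all_boot all_order all_algebra.
From mathcomp Require Import all_classical all_reals all_analysis.
From mathcomp Require Import measurable_realfun.

Set Implicit Arguments.
Unset Strict Implicit.
Unset Printing Implicit Defensive.

Import Order.TTheory GRing.Theory Num.Theory.
Import numFieldNormedType.Exports.

Local Open Scope classical_set_scope.
Local Open Scope ring_scope.
Local Open Scope ereal_scope.

Section densities.
Context {R : realType}.

Definition is_density (Q : probability R R) (q : R -> R) : Prop :=
  [/\ measurable_fun [set: R] q,
      forall x, (0 <= q x)%R &
      forall A : set R, measurable A ->
        Q A = \int[@lebesgue_measure R]_(x in A) (q x)%:E].

Definition supp (q : R -> R) : set R := [set x | (0 < q x)%R].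

End densities.

(* Meant for open [A] in a finite-dimensional [V]: there, continuity of
   z |-> 'd g z v for every direction v is continuity of z |-> 'd g z in
   operator norm. *)
Definition continuously_differentiable_on {R : realType}
    {V W : normedModType R} (A : set V) (g : V -> W) : Prop :=
  (forall z, A z -> differentiable g z) /\
  (forall v z, A z -> {for z, continuous (fun y => 'd g y v)}).

(* R^m has no canonical measurableType instance on row vectors, so R x R^m is
   given the sigma-algebra generated by its open sets; D is meant to be open. *)
Definition borel_measurable_on {R : realType} {m : nat}
    (D : set (R * 'rV[R]_m)) (g : R * 'rV[R]_m -> R) : Prop :=
  @measurable_fun _ _
    (g_sigma_algebraType (@open (R * 'rV[R]_m)%type)) R D g.

Section infinite_product.
Context {R : realType}.

Definition coordinate_preimages : set (set (nat -> R)) :=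
  [set C | exists k (B : set R),
     measurable B /\ C = [set w : nat -> R | B (w k)]].

(* R^oo with the product sigma-algebra; the k-th coordinate projection is
   w |-> w k, with coordinates numbered from 0. *)
Definition Rinfty : Type := g_sigma_algebraType coordinate_preimages.

(* The product rule on finite-dimensional rectangles determines P^oo uniquely
   among the probability measures on the product sigma-algebra. *)
Definition is_infinite_product (P : probability R R)
    (Pinf : probability Rinfty R) : Prop :=
  forall (n : nat) (B : nat -> set R), (forall k, measurable (B k)) ->
    Pinf [set w : Rinfty | forall k, (k < n)%N -> B k (w k)] =
    \prod_(k < n) P (B k).

End infinite_product.

Arguments Rinfty R : clear implicits.

Section minimal_measurable_cover.
Context {d : measure_display} {S : measurableType d} {R : realType}.

Definition is_minimal_measurable_cover (mu : probability S R)
    (h hstar : S -> \bar R) : Prop :=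
  [/\ measurable_fun [set: S] hstar,
      forall w, h w <= hstar w &
      forall g : S -> \bar R, measurable_fun [set: S] g ->
        (forall w, h w <= g w) -> {ae mu, forall w, hstar w <= g w}].

Lemma minimal_measurable_cover_unique (mu : probability S R)
    (h h1 h2 : S -> \bar R) :
  is_minimal_measurable_cover mu h h1 ->
  is_minimal_measurable_cover mu h h2 -> {ae mu, forall w, h1 w = h2 w}.
Proof.
move=> [mh1 hh1 min1] [mh2 hh2 min2].
have le12 := min1 _ mh2 hh2.
have le21 := min2 _ mh1 hh1.
by near=> w; apply/eqP; rewrite eq_le; apply/andP; split; near: w.
Unshelve. all: by end_near.
Qed.

(* Versions of a minimal measurable cover agree almost surely, so the choice
   of the sequence [H] does not affect the almost sure limit. *)
Definition strongly_consistent (mu : probability S R)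
    (est : nat -> S -> \bar R) (theta : \bar R) : Prop :=
  exists H : nat -> S -> \bar R,
    (forall n, is_minimal_measurable_cover mu
                 (fun w => `| est n w - theta |) (H n)) /\
    {ae mu, forall w, H n w @[n --> \oo] --> 0}.

End minimal_measurable_cover.

Section estimator.
Context {R : realType} {I : Type}.

Definition lower_expectation (T : set I) (P : I -> probability R R)
    (f : R -> R) : \bar R :=
  ereal_inf [set 'E_(P t)[f] | t in T].

Definition importance_estimator (T : set I) (ft : I -> R -> R)
    (n : nat) (w : Rinfty R) : \bar R :=
  ereal_inf [set (n%:R^-1 * \sum_(k < n) ft t (w k))%R%:E | t in T].

End estimator.

(* Main.v *)
Require Import Defs.
From HB Require Import structures.
From mathcomp Require Import all_boot all_order all_algebra.
From mathcomp Require Import all_classical all_reals all_analysis.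
From mathcomp Require Import measurable_realfun.
From mathcomp Require Import finmap ring lra.
Import Order.TTheory GRing.Theory Num.Theory.
Import numFieldNormedType.Exports.
Local Open Scope classical_set_scope.
Local Open Scope ring_scope.

Set Implicit Arguments.
Unset Strict Implicit.
Unset Printing Implicit Defensive.

(* The strong law of large numbers for an integrable g: write g = b + r with b
   bounded and r small in L1.  The average Z of N centred copies of b is small
   in L1 by a second moment bound, and the averages of b - E b differ from those
   of Z along the shift by O(1/n) only.  Garsia's
   maximal ergodic inequality for the shift, applied to |Z| + |r|, then bounds
   all averages at once outside an event of small probability.

   The uniform law: t |-> f p_t(x) / p(x) is continuous on the compact T, with
   an integrable envelope, so by dominated convergence the oscillation over
   small balls is small in mean.  Finitely many such balls cover T, and the
   strong law is applied at their centres and to their oscillation bounds.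

   Infima over T are infima over a dense sequence, hence measurable, so on the
   almost sure event where every coordinate lies in supp p the minimal
   measurable cover is the absolute error itself; elsewhere it is set to +oo. *)

(** * Maximal ergodic inequality *)

Section maximal_inequality.
Context d (S : measurableType d) (R : realType) (mu : probability S R).
Variables (T : S -> S) (mT : measurable_fun [set: S] T).
Hypothesis T_preserving : forall A, measurable A -> mu (T @^-1` A) = mu A.
Variables (h : S -> R) (mh : measurable_fun [set: S] h).
Hypothesis h_ge0 : forall w, 0 <= h w.
Hypothesis h_integrable : (\int[mu]_w (h w)%:E < +oo)%E.

Lemma ge0_integral_preserving (g : S -> \bar R) :
  measurable_fun [set: S] g -> (forall w, 0 <= g w)%E ->
  (\int[mu]_w g (T w) = \int[mu]_w g w)%E.
Proof.
move=> mg g0.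
transitivity (\int[pushforward mu T]_w g w)%E.
  by rewrite ge0_integral_pushforward//= ?preimage_setT.
by apply: eq_measure_integral => A mA _; exact: T_preserving.
Qed.

Variable l : R.
Hypothesis l_gt0 : 0 < l.

(* [maxsum n w] is the maximum over [k <= n] of
   [\sum_(i < k) (h (T^i w) - l)]. *)
Fixpoint maxsum (n : nat) (w : S) : R :=
  if n is k.+1 then Num.max 0 (h w - l + maxsum k (T w)) else 0.

Lemma maxsum_ge0 n w : 0 <= maxsum n w.
Proof. by case: n => //= n; rewrite le_max lexx. Qed.

Lemma maxsumS n w : maxsum n w <= maxsum n.+1 w.
Proof.
elim: n w => [|n IH] w; first exact: maxsum_ge0.
rewrite [X in X <= _]/= [X in _ <= X]/= ge_max !le_max lexx/= lerD2l IH.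
by rewrite orbT.
Qed.

Lemma measurable_maxsum n : measurable_fun [set: S] (maxsum n).
Proof.
elim: n => [|n IH] /=; first exact: measurable_cst.
apply: measurable_maxr => //.
by apply: measurable_funD; [exact: measurable_funB|exact: measurableT_comp].
Qed.

Lemma measurable_maxsum_pos n : measurable [set w | 0 < maxsum n w].
Proof.
rewrite (_ : [set _ | _] = setT `&` maxsum n @^-1` `]0, +oo[).
  by apply: measurable_maxsum => //; exact: measurable_itv.
by rewrite setTI; apply/seteqP; split => w /=; rewrite in_itv/= andbT.
Qed.

Lemma maxsum_ge n w : \sum_(k < n) h (iter k T w) - n%:R * l <= maxsum n w.
Proof.
elim: n w => [|n IH] w; first by rewrite big_ord0 mul0r subr0.
rewrite big_ord_recl [X in _ <= X]/= le_max; apply/orP; right.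
under eq_bigr do rewrite lift0 iterSr.
by have := IH (T w); rewrite -natr1; lra.
Qed.

(** The recursion gives [maxsum n.+1 <= h + maxsum n \o T], and invariance turns the integral of the
    last term into that of [maxsum n]. Finiteness is what permits cancellation in
    [maxsum_pos_le]. *)
Lemma maxsum_integrable n : (\int[mu]_w (maxsum n w)%:E < +oo)%E.
Proof.
elim: n => [|n IH]; first by rewrite /= integral0.
have mMT : measurable_fun [set: S] (fun w => (maxsum n (T w))%:E).
  apply/measurable_EFinP.
  by apply: (@measurableT_comp _ _ _ _ _ _ (maxsum n)) => //;
    exact: measurable_maxsum.
have mM k : measurable_fun [set: S] (fun w => (maxsum k w)%:E).
  by apply/measurable_EFinP; exact: measurable_maxsum.
apply: (@le_lt_trans _ _ (\int[mu]_w ((h w)%:E + (maxsum n (T w))%:E))%E).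
  apply: ge0_le_integral => //.
  - by move=> w _; rewrite lee_fin maxsum_ge0.
  - by apply: emeasurable_funD => //; exact/measurable_EFinP.
  - move=> w _; rewrite -EFinD lee_fin /= ge_max addr_ge0 ?maxsum_ge0//=.
    by rewrite lerD2r lerBlDr lerDl ltW.
rewrite ge0_integralD//; last 3 first.
- by move=> w _; rewrite lee_fin.
- exact/measurable_EFinP.
- by move=> w _; rewrite lee_fin maxsum_ge0.
rewrite (@ge0_integral_preserving (fun w => (maxsum n w)%:E))//.
- by rewrite lte_add_pinfty.
- by move=> w; rewrite lee_fin maxsum_ge0.
Qed.

(** Garsia's argument. Where [maxsum n.+1] is positive it equals [h - l + maxsum n \o T]; elsewhere
    it is 0. With [A] the set of positivity, [maxsum n.+1 + l * \1_A <= maxsum n \o T + h] therefore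
    holds everywhere. After integration, invariance removes [T], and [maxsum n <= maxsum n.+1] lets
    the two integrals cancel. *)
Lemma maxsum_pos_le n :
  (l%:E * mu [set w | (0 < maxsum n w)%R] <= \int[mu]_w (h w)%:E)%E.
Proof.
case: n => [|n].
  rewrite (_ : [set w | _] = set0) ?measure0 ?mule0.
    by apply: integral_ge0 => w _; rewrite lee_fin.
  by apply/seteqP; split => // w /=; rewrite ltxx.
set A := [set w | _].
have mA : measurable A by exact: measurable_maxsum_pos.
have mM k : measurable_fun [set: S] (fun w => (maxsum k w)%:E).
  by apply/measurable_EFinP; exact: measurable_maxsum.
have M0 k w : (0 <= (maxsum k w)%:E)%E by rewrite lee_fin maxsum_ge0.
have mMT : measurable_fun [set: S] (fun w => (maxsum n (T w))%:E).
  exact: (@measurableT_comp _ _ _ _ _ _ (fun w => (maxsum n w)%:E)).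
have mindA : measurable_fun [set: S] (fun w => (l * \1_A w)%:E).
  apply/measurable_EFinP.
  by apply: measurable_funM; [exact: measurable_cst|exact: measurable_indic].
have fin : (\int[mu]_w (maxsum n.+1 w)%:E)%E \is a fin_num.
  rewrite ge0_fin_numE; first exact: maxsum_integrable.
  by apply: integral_ge0 => w _; exact: M0.
suff : (\int[mu]_w (maxsum n.+1 w)%:E + l%:E * mu A <=
        \int[mu]_w (maxsum n.+1 w)%:E + \int[mu]_w (h w)%:E)%E.
  by rewrite leeD2lE.
apply: (@le_trans _ _ (\int[mu]_w ((maxsum n (T w))%:E + (h w)%:E))%E).
  have -> : (l%:E * mu A = \int[mu]_w (l * \1_A w)%:E)%E.
    under eq_integral do rewrite EFinM.
    rewrite ge0_integralZl ?lee_fin ?ltW//.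
      by rewrite integral_indic ?setIT.
    exact/measurable_EFinP/measurable_indic.
  rewrite -ge0_integralD//; last first.
    by move=> w _; rewrite lee_fin mulr_ge0 // ltW.
  apply: ge0_le_integral => //.
  - by move=> w _; rewrite adde_ge0 ?M0// lee_fin mulr_ge0 // ltW.
  - exact: emeasurable_funD.
  - by apply: emeasurable_funD => //; exact/measurable_EFinP.
  - move=> w _; rewrite -!EFinD lee_fin indicE.
    have [wA|wA] := boolP (w \in A).
      move: wA => /set_mem; rewrite /A /= lt_max ltxx /= => /ltW wA.
      by rewrite max_r// mulr1; lra.
    have -> : maxsum n.+1 w = 0.
      apply/eqP; rewrite eq_le maxsum_ge0 andbT leNgt; apply/negP => H.
      by move/negP: wA; apply; exact: mem_set.
    by rewrite mulr0 addr0 addr_ge0 ?maxsum_ge0.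
rewrite ge0_integralD//; last 2 first.
- by move=> w _; rewrite lee_fin.
- exact/measurable_EFinP.
rewrite (@ge0_integral_preserving (fun w => (maxsum n w)%:E))//.
apply: leeD => //; apply: ge0_le_integral => // w _.
by rewrite lee_fin maxsumS.
Qed.

(** The event is the increasing union of the sets where [maxsum n] is positive, so continuity from
    below carries the bound of [maxsum_pos_le] over; a single event controls all [n] at once. *)
Lemma maximal_inequality : exists2 A : set S, measurable A &
  (l%:E * mu A <= \int[mu]_w (h w)%:E)%E /\
  forall n w, n%:R * l < \sum_(k < n) h (iter k T w) -> A w.
Proof.
pose F n := [set w | 0 < maxsum n w].
have mF n : measurable (F n) by exact: measurable_maxsum_pos.
exists (\bigcup_n F n); first exact: bigcupT_measurable.
split; last first.
  move=> n w H; exists n => //; rewrite /F /=.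
  by apply: lt_le_trans (maxsum_ge n w); rewrite subr_gt0.
have cF : (mu (F n) @[n --> \oo] --> mu (\bigcup_n F n))%E.
  apply: nondecreasing_cvg_mu => //; first exact: bigcupT_measurable.
  apply/nondecreasing_seqP => n; apply/subsetPset => w; rewrite /F /=.
  by move/lt_le_trans; apply; exact: maxsumS.
have /cvg_lim <- // :
    (l%:E * mu (F n) @[n --> \oo] --> l%:E * mu (\bigcup_n F n))%E.
  by apply: cvgeZl.
apply: lime_le; last by apply: nearW => n; exact: maxsum_pos_le.
by apply: is_cvgeZl => //; apply/cvg_ex; eexists; exact: cF.
Qed.

End maximal_inequality.

(** * Infinite products *)

Section coordinates.
Context {R : realType}.

Lemma measurable_coord (k : nat) :
  measurable_fun [set: Rinfty R] (fun w : Rinfty R => w k).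
Proof.
move=> _ B mB; rewrite setTI; apply: sub_sigma_algebra.
by exists k, B.
Qed.

Definition shift (w : Rinfty R) : Rinfty R := fun i => w i.+1.

Lemma iter_shift n (w : Rinfty R) k : iter n shift w k = w (n + k)%N.
Proof. by elim: n w k => //= n IH w k; rewrite /shift IH addnS. Qed.

Lemma measurable_shift : measurable_fun [set: Rinfty R] shift.
Proof.
apply: (@measurability _ _ (Rinfty R) (Rinfty R) _ _ (@coordinate_preimages R)
  erefl) => _ [C [k [B [mB ->]]] <-].
rewrite setTI; apply: sub_sigma_algebra.
by exists k.+1, B.
Qed.

Definition cylinder (n : nat) (B : nat -> set R) : set (Rinfty R) :=
  [set w | forall k, (k < n)%N -> B k (w k)].

Definition cylinders : set (set (Rinfty R)) :=
  [set C | exists n B, (forall k, measurable (B k)) /\ C = cylinder n B].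

Lemma measurable_cylinder n B : (forall k, measurable (B k)) ->
  measurable (cylinder n B).
Proof.
move=> mB.
have -> : cylinder n B =
    \bigcap_(k in [set k | (k < n)%N]) ((fun w : Rinfty R => w k) @^-1` B k).
  by apply/seteqP; split => w /= H k; exact: H.
apply: bigcap_measurableType => k _; rewrite -[X in measurable X]setTI.
exact: measurable_coord.
Qed.

(** With [cylinders_setI] this makes the cylinders a generating pi-system, on which equality of two
    probability measures can be tested. *)
Lemma cylinders_measurable : @measurable _ (Rinfty R) = <<s cylinders >>.
Proof.
apply/seteqP; split; apply: smallest_sub.
- exact: smallest_sigma_algebra.
- move=> _ [k [B [mB ->]]]; apply: sub_sigma_algebra.
  exists k.+1, (fun i => if i == k then B else setT); split.
    by move=> i; case: ifP.
  apply/seteqP; split => w /=.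
    by move=> Bw i _; case: eqP => [->|].
  by move=> /(_ k (ltnSn k)); rewrite eqxx.
- exact: sigma_algebra_measurable.
- by move=> _ [n [B [mB ->]]]; exact: measurable_cylinder.
Qed.

Lemma cylinders_setI : setI_closed cylinders.
Proof.
move=> _ _ [n [B [mB ->]]] [m [C [mC ->]]].
exists (maxn n m), (fun k => (if (k < n)%N then B k else setT) `&`
  (if (k < m)%N then C k else setT)); split.
  by move=> k; apply: measurableI; case: ifP.
apply/seteqP; split => w /=.
  by move=> [Bw Cw] k _; split; case: ifP => // ?; [exact: Bw|exact: Cw].
move=> H; split => k kn.
  by have [] := H k (leq_trans kn (leq_maxl _ _)); rewrite kn.
by have [] := H k (leq_trans kn (leq_maxr _ _)); rewrite kn.
Qed.

End coordinates.

(** * Bounded integrands and negligible events *)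

Section probability_extra.
Context d (S : measurableType d) (R : realType) (mu : probability S R).

Lemma bounded_integrable (g : S -> R) C : measurable_fun [set: S] g ->
  (forall x, `|g x| <= C) -> mu.-integrable setT (EFin \o g).
Proof.
move=> mg gC; apply: measurable_bounded_integrable => //.
  by rewrite (le_lt_trans (probability_le1 _ _)) ?ltry.
exists C; split; first exact: num_real.
by move=> M CM w _ /=; rewrite (le_trans _ (ltW CM)).
Qed.

(** Covers of measure at most [n.+1%:R^-1] are intersected over [n]. The set [E] itself may be
    non-measurable, hence the conclusion in terms of negligibility. *)
Lemma arbitrarily_small_negligible (E : set S) :
  (forall e : R, 0 < e ->
    exists2 A : set S, measurable A & (mu A <= e%:E)%E /\ E `<=` A) ->
  mu.-negligible E.
Proof.
move=> H.
have {}H n : {A : set S |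
    [/\ measurable A, (mu A <= (n.+1%:R^-1)%:E)%E & E `<=` A]}.
  apply: cid; have [|A mA [muA EA]] := H n.+1%:R^-1; first by rewrite invr_gt0.
  by exists A.
pose A n := sval (H n).
have mA n : measurable (A n) by rewrite /A; case: (H n) => ? [].
have muA n : (mu (A n) <= (n.+1%:R^-1)%:E)%E by rewrite /A; case: (H n) => ? [].
have EA n : E `<=` A n by rewrite /A; case: (H n) => ? [].
exists (\bigcap_n A n); split; last by move=> x Ex n _; exact: EA.
  exact: bigcapT_measurable.
apply/eqP; rewrite eq_le measure_ge0 andbT.
apply/lee_addgt0Pr => e e0; rewrite add0e.
have [n ne] : exists n : nat, n.+1%:R^-1 <= e.
  exists (Num.truncn e^-1); rewrite -[leRHS]invrK lef_pV2 ?posrE ?invr_gt0//.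
  exact/ltW/truncnS_gt.
apply: (@le_trans _ _ (mu (A n))).
  apply: le_measure; last exact: bigcap_inf.
    by apply: mem_set; exact: bigcapT_measurable.
  exact: mem_set.
by apply: le_trans (muA n) _; rewrite lee_fin.
Qed.

End probability_extra.

(** * Shift invariance and second moments under the product measure *)

Section infinite_product_theory.
Context {R : realType}.
Variables (P : probability R R) (Pinf : probability (Rinfty R) R).
Hypothesis Pinf_prod : is_infinite_product P Pinf.

Lemma cylinder_probability n B : (forall k, measurable (B k)) ->
  Pinf (cylinder n B) = (\prod_(k < n) P (B k))%E.
Proof. exact: Pinf_prod. Qed.

(** By uniqueness on the cylinders: the preimage of a cylinder is a cylinder one coordinate longer,
    whose free first coordinate contributes a factor 1. *)
Lemma shift_preserving A : measurable A -> Pinf (shift @^-1` A) = Pinf A.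
Proof.
move=> mA.
have mS := @measurable_shift R.
pose s : {mfun Rinfty R >-> Rinfty R} :=
  HB.pack (@shift R) (isMeasurableFun.Build _ _ _ _ _ mS).
apply: (measure_unique cylinders (fun=> setT) _ _ _ _
  (pushforward Pinf s) Pinf) => //.
- exact: cylinders_measurable.
- exact: cylinders_setI.
- move=> _; exists 0%N, (fun=> setT); split => //.
  by apply/seteqP; split.
- by apply/seteqP; split => // w _; exists 0%N.
- move=> _ [n [B [mB ->]]].
  transitivity (\prod_(k < n) P (B k))%E; last first.
    exact/esym/cylinder_probability.
  pose B' k := if k is i.+1 then B i else setT.
  have mB' k : measurable (B' k) by case: k => [|k]; [exact: measurableT|exact: mB].
  transitivity (Pinf (cylinder n.+1 B')); last first.
    by rewrite cylinder_probability// big_ord_recl /= probability_setT mul1e.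
  rewrite /pushforward; congr (Pinf _).
  apply/seteqP; split => w H; first by case=> // k kn; exact: H.
  by move=> k kn; exact: (H k.+1).
- by move=> k; rewrite /= /pushforward preimage_setT probability_setT ltry.
Qed.

Lemma coord_probability k A : measurable A ->
  Pinf ((fun w : Rinfty R => w k) @^-1` A) = P A.
Proof.
move=> mA.
pose B i := if i == k then A else setT.
have mB i : measurable (B i) by rewrite /B; case: ifP.
have -> : (fun w : Rinfty R => w k) @^-1` A = cylinder k.+1 B.
  apply/seteqP; split => w /=.
    by move=> Aw i _; rewrite /B; case: eqP => [->|].
  by move=> /(_ k (ltnSn k)); rewrite /B eqxx.
rewrite cylinder_probability// (bigD1 ord_max)//= /B eqxx big1 ?mule1// => i.
rewrite -(inj_eq val_inj) /= => /negbTE ->; exact: probability_setT.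
Qed.

Lemma coord_pair_probability j k A B : j != k -> measurable A -> measurable B ->
  Pinf ((fun w : Rinfty R => (w j, w k)) @^-1` (A `*` B)) = (P A * P B)%E.
Proof.
move=> jk mA mB.
pose C i := if i == j then A else if i == k then B else setT.
have mC i : measurable (C i) by rewrite /C; case: ifP => // _; case: ifP.
have -> : (fun w : Rinfty R => (w j, w k)) @^-1` (A `*` B) =
    (* The length [(j + k).+1] exceeds both indices, whichever is larger. *)
    cylinder (j + k).+1 C.
  apply/seteqP; split => w /=.
    by move=> [Aw Bw] i _; rewrite /C; case: eqP => [->|_] //; case: eqP => [->|].
  move=> H; split.
    by have := H j; rewrite /C eqxx; apply; rewrite ltnS leq_addr.
  by have := H k; rewrite /C eq_sym (negbTE jk) eqxx; apply; rewrite ltnS leq_addl.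
have ltj : (j < (j + k).+1)%N by rewrite ltnS leq_addr.
have ltk : (k < (j + k).+1)%N by rewrite ltnS leq_addl.
rewrite cylinder_probability// (bigD1 (Ordinal ltj))//= {1}/C eqxx.
rewrite (bigD1 (Ordinal ltk))/=; last by rewrite -(inj_eq val_inj) /= eq_sym.
rewrite {1}/C eq_sym (negbTE jk) eqxx big1 ?mule1// => i.
rewrite -!(inj_eq val_inj) /= /C => /andP[/negbTE -> /negbTE ->].
exact: probability_setT.
Qed.

Lemma ge0_integral_coord k (g : R -> \bar R) : measurable_fun [set: R] g ->
  (forall x, 0 <= g x)%E -> (\int[Pinf]_w g (w k) = \int[P]_x g x)%E.
Proof.
move=> mg g0; have mk := @measurable_coord R k.
transitivity (\int[pushforward Pinf (fun w : Rinfty R => w k)]_x g x)%E.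
  by rewrite (ge0_integral_pushforward mk)//= ?preimage_setT.
by apply: eq_measure_integral => A mA _; exact: coord_probability.
Qed.

(** Two distinct coordinates have joint law [P \x P], since the two measures agree on rectangles.
    Fubini then leaves an inner integral that is a multiple of the mean of [g]; boundedness supplies
    integrability. *)
Lemma integral_coordM j k (g : R -> R) C : j != k ->
  measurable_fun [set: R] g -> (forall x, `|g x| <= C) ->
  (\int[P]_x (g x)%:E = 0)%E -> (\int[Pinf]_w (g (w j) * g (w k))%:E = 0)%E.
Proof.
move=> jk mg gC Eg0.
have C0 : 0 <= C by exact: le_trans (gC 0).
have mp : measurable_fun [set: Rinfty R] (fun w : Rinfty R => (w j, w k)).
  by apply: measurable_fun_pair; exact: measurable_coord.
pose F (z : R * R) := (g z.1 * g z.2)%:E.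
have mF : measurable_fun [set: R * R] F.
  apply/measurable_EFinP; apply: measurable_funM.
    exact: (measurableT_comp mg measurable_fst).
  exact: (measurableT_comp mg measurable_snd).
have FC z : (`|F z| <= (C * C)%:E)%E.
  by rewrite /F lee_fin normrM ler_pM.
pose p : {mfun Rinfty R >-> (R * R)%type} :=
  HB.pack (fun w : Rinfty R => (w j, w k)) (isMeasurableFun.Build _ _ _ _ _ mp).
have iF : Pinf.-integrable setT (F \o p).
  apply: (@bounded_integrable _ _ _ _ (fun w : Rinfty R => g (w j) * g (w k))
    (C * C)); first by apply/measurable_EFinP; exact: (measurableT_comp mF mp).
  by move=> w; rewrite -lee_fin; exact: (FC (p w)).
have iF2 : (P \x P)%E.-integrable setT F.
  apply: (@measurable_bounded_integrable _ _ _ (P \x P)%E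
    (fun z : R * R => g z.1 * g z.2)) => //.
  - have : (P \x P)%E ([set: R] `*` [set: R]) = (1 * 1)%E.
      transitivity (P setT * P setT)%E; first exact: product_measure1E.
      by congr (_ * _)%E; exact: probability_setT.
    rewrite setXTT mul1e => /eqP; rewrite eq_le => /andP[le1 _].
    exact: le_lt_trans le1 (ltry 1).
  - exact/measurable_EFinP.
  - exists (C * C); split; first exact: num_real.
    by move=> M CM z _ /=; rewrite (le_trans _ (ltW CM))// -lee_fin (FC z).
transitivity (\int[pushforward Pinf p]_z F z)%E.
  by rewrite integral_pushforward ?preimage_setT//.
transitivity (\int[P \x P]_z F z)%E.
  apply: eq_measure_integral => A mA _.
  apply/esym/product_measure_unique => //= A1 A2 mA1 mA2.
  exact: coord_pair_probability.
rewrite -integral12_prod_meas1//.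
transitivity (\int[P]_x (cst 0 x))%E; last by rewrite integral_cst// mul0e.
apply: eq_integral => x _ /=.
rewrite /fubini_F /F /=.
under eq_integral do rewrite EFinM.
rewrite integralZl// ?Eg0 ?mule0//.
exact: (bounded_integrable _ mg gC).
Qed.

(** In the expanded square the off-diagonal terms vanish by [integral_coordM], and each of the [N]
    diagonal terms is at most [C ^+ 2]. *)
Lemma second_moment N (g : R -> R) C : measurable_fun [set: R] g ->
  (forall x, `|g x| <= C) -> (\int[P]_x (g x)%:E = 0)%E ->
  (\int[Pinf]_w ((\sum_(j < N) g (w j)) ^+ 2)%:E <= (N%:R * C ^+ 2)%:E)%E.
Proof.
move=> mg gC Eg0.
have C0 : 0 <= C by exact: le_trans (gC 0).
have gCC (w : Rinfty R) j k : `|g (w j) * g (w k)| <= C ^+ 2.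
  by rewrite normrM expr2 ler_pM.
have mgg j k : measurable_fun [set: Rinfty R] (fun w => g (w j) * g (w k)).
  by apply: measurable_funM; apply: (measurableT_comp mg); exact: measurable_coord.
have E (w : Rinfty R) : ((\sum_(j < N) g (w j)) ^+ 2)%:E =
    (\sum_(i : 'I_N * 'I_N) (g (w i.1) * g (w i.2))%:E)%E.
  by rewrite expr2 big_distrlr pair_big /= sumEFin.
under eq_integral do rewrite E.
rewrite integral_sum//; last first.
  by move=> i; apply: (bounded_integrable _ (mgg _ _) (C := C ^+ 2)) => w; exact: gCC.
apply: (@le_trans _ _ (\sum_(i : 'I_N * 'I_N)
    (if i.1 == i.2 then C ^+ 2 else 0)%:E)%E).
  apply: lee_sum => -[j k] _ /=; case: eqVneq => [<-|jk]; last first.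
    by rewrite (integral_coordM _ mg gC Eg0).
  apply: (@le_trans _ _ (\int[Pinf]_w (cst (C ^+ 2)%:E w))%E).
    apply: ge0_le_integral => //.
    - by move=> w _; rewrite lee_fin -expr2 sqr_ge0.
    - exact/measurable_EFinP.
    - by move=> w _; rewrite lee_fin (le_trans (ler_norm _)).
  rewrite integral_cst// [X in (_ * X)%E](_ : _ = 1%E) ?mule1//.
  exact: probability_setT.
rewrite sumEFin lee_fin.
rewrite -(pair_big xpredT xpredT (fun j k => if j == k then C ^+ 2 else 0)) /=.
rewrite [leLHS](eq_bigr (fun=> C ^+ 2)) => [|j _].
  by rewrite sumr_const card_ord mulr_natl.
by rewrite -big_mkcond (big_pred1 j)// => k; rewrite /= eq_sym.
Qed.

End infinite_product_theory.

(** * Strong law of large numbers *)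

Section strong_law.
Context {R : realType}.
Implicit Types phi : nat -> R.

(** Each unit shift of the window drops [phi j] and gains [phi (n + j)], a change of at most
    [2 C]. *)
Lemma sum_shift_diff phi C n j : (forall k, `|phi k| <= C) ->
  `|\sum_(k < n) phi (k + j)%N - \sum_(k < n) phi k| <= j%:R * (C *+ 2).
Proof.
move=> phiC; elim: j => [|j IH].
  by under eq_bigr do rewrite addn0; rewrite subrr normr0 mul0r.
have -> : \sum_(k < n) phi (k + j.+1)%N - \sum_(k < n) phi k =
    (phi (n + j)%N - phi j) + (\sum_(k < n) phi (k + j)%N - \sum_(k < n) phi k).
  suff -> : \sum_(k < n) phi (k + j.+1)%N =
      phi (n + j)%N - phi j + \sum_(k < n) phi (k + j)%N by rewrite addrA.
  (* The same sum of [n.+1] terms is split once at its first term and once at its last. *)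
  have := erefl (\sum_(k < n.+1) phi (k + j)%N).
  rewrite {1}big_ord_recl big_ord_recr.
  under eq_bigr do rewrite lift0 addSnnS.
  by rewrite /= add0n; lra.
rewrite -natr1 mulrDl mul1r addrC (le_trans (ler_normD _ _))// lerD//.
by rewrite (le_trans (ler_normB _ _))// mulr2n lerD.
Qed.

(* The averages of [phi] and those of its moving averages differ by boundary
   terms only. *)
Lemma sum_moving_average_diff phi C n N : (forall k, `|phi k| <= C) ->
  `|\sum_(k < n) (N.+1%:R^-1 * \sum_(j < N.+1) phi (k + j)%N)
    - \sum_(k < n) phi k| <= N.+1%:R * (C *+ 2).
Proof.
move=> phiC.
have C0 : 0 <= C by exact: le_trans (phiC 0%N).
rewrite -mulr_sumr exchange_big /=.
have -> : \sum_(k < n) phi k =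
    N.+1%:R^-1 * \sum_(j < N.+1) \sum_(k < n) phi k.
  rewrite sumr_const card_ord -[X in _ = _ * X]mulr_natl mulrA.
  by rewrite mulVf ?mul1r// pnatr_eq0.
rewrite -mulrBr -sumrB normrM ger0_norm ?invr_ge0// ler_pdivrMl ?ltr0n//.
apply: (le_trans (ler_norm_sum _ _ _)).
apply: (@le_trans _ _ (\sum_(j < N.+1) N.+1%:R * (C *+ 2))).
  apply: ler_sum => j _; apply: le_trans (sum_shift_diff _ _ phiC) _.
  by rewrite ler_wpM2r ?mulrn_wge0// ler_nat ltnW.
by rewrite sumr_const card_ord [leRHS]mulr_natl.
Qed.

Variables (P : probability R R) (Pinf : probability (Rinfty R) R).
Hypothesis Pinf_prod : is_infinite_product P Pinf.

Import HBSimple.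

(** Simple functions are dense in L1, and each of them is bounded. *)
Lemma L1_bounded_approx (g : R -> R) (e : R) : 0 < e ->
  P.-integrable setT (EFin \o g) ->
  exists b : R -> R, [/\ measurable_fun [set: R] b,
    exists C, forall x, `|b x| <= C &
    (\int[P]_x (`|g x - b x|)%:E <= e%:E)%E].
Proof.
move=> e0 ig.
have [b [ib _ bg]] := approximation_sfun_integrable measurableT ig.
have e0' : (0 < e%:E)%E by rewrite lte_fin.
have [n _ /(_ n (leqnn n)) H]  :=
  bg _ (open_ereal_lt' e0').
exists (b n); split; first exact: measurable_funPT.
  have [M [_ HM]] := simple_bounded (b n).
  by exists (M + 1) => x; apply: HM => //; rewrite ltrDl.
by move/ltW: H; apply: le_trans; rewrite le_eqVlt; apply/orP; left.
Qed.

(** Smallness in mean is the form that the maximal inequality consumes. It follows from the second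
    moment through a pointwise bound of [|z|] by a constant plus a multiple of [z ^ 2]. *)
Lemma weak_law (b : R -> R) C (e : R) : 0 < e ->
  measurable_fun [set: R] b -> (forall x, `|b x| <= C) ->
  (\int[P]_x (b x)%:E = 0)%E -> exists N,
  (\int[Pinf]_w (`|N.+1%:R^-1 * \sum_(j < N.+1) b (w j)|)%:E <= e%:E)%E.
Proof.
move=> e0 mb bC Eb0.
pose d := e / 2; have d0 : 0 < d by rewrite divr_gt0.
(* This makes the quadratic term, of integral at most [C ^+ 2 / (d * N.+1%:R)], no larger than [d];
   the constant term is [d] as well, and [d + d = e]. *)
pose N := Num.truncn (C ^+ 2 / d ^+ 2); exists N.
have NC : C ^+ 2 / d ^+ 2 <= N.+1%:R by exact/ltW/truncnS_gt.
have N0 : 0 < N.+1%:R :> R by [].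
have mS : measurable_fun [set: Rinfty R] (fun w => \sum_(j < N.+1) b (w j)).
  apply: measurable_sum => j; apply: (measurableT_comp mb).
  exact: measurable_coord.
pose c := N.+1%:R ^- 2 / d.
have c0 : 0 <= c by rewrite mulr_ge0 ?invr_ge0 ?exprn_ge0// ltW.
apply: (@le_trans _ _ (\int[Pinf]_w
    (cst d%:E w + c%:E * ((\sum_(j < N.+1) b (w j)) ^+ 2)%:E))%E).
  apply: ge0_le_integral => //.
  - apply/measurable_EFinP; apply: measurableT_comp => //.
    by apply: measurable_funM.
  - apply/measurable_EFinP; apply: measurable_funD => //.
    by apply: measurable_funM => //; exact: measurable_funX.
  - move=> w _; rewrite -EFinM -EFinD lee_fin; set s := \sum_(j < _) _.
    rewrite normrM ger0_norm ?invr_ge0// /c.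
    (* AM-GM: [|z| <= d + z ^ 2 / d] *)
    have -> : N.+1%:R ^- 2 / d * s ^+ 2 = (N.+1%:R^-1 * `|s|) ^+ 2 / d.
      by rewrite exprMn real_normK ?num_real// exprVn mulrAC.
    set z := _ * `|s|; have z0 : 0 <= z by rewrite mulr_ge0 ?invr_ge0.
    have [zd|/ltW dz] := leP z d.
      by rewrite (le_trans zd)// lerDl divr_ge0 ?exprn_ge0// ltW.
    rewrite (@le_trans _ _ (z ^+ 2 / d))//; last by rewrite lerDr ltW.
    by rewrite ler_pdivlMr// expr2 ler_wpM2l.
rewrite ge0_integralD//; last 3 first.
- by move=> w _; rewrite lee_fin ltW.
- by move=> w _; rewrite -EFinM lee_fin mulr_ge0 ?sqr_ge0.
- apply/measurable_EFinP; apply: measurable_funM => //.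
  exact: measurable_funX.
rewrite ge0_integralZl//; last 2 first.
- by apply/measurable_EFinP; exact: measurable_funX.
- by move=> w _; rewrite lee_fin sqr_ge0.
rewrite [e](splitr e) EFinD; apply: leeD.
  rewrite integral_cst// [X in (_ * X)%E](_ : _ = 1%E) ?mule1//.
  exact: probability_setT.
apply: (@le_trans _ _ (c%:E * (N.+1%:R * C ^+ 2)%:E)%E).
  by apply: lee_wpmul2l; rewrite ?lee_fin//; exact: (second_moment Pinf_prod).
rewrite -EFinM lee_fin /c -/d.
have -> : N.+1%:R ^- 2 / d * (N.+1%:R * C ^+ 2) = C ^+ 2 / d ^+ 2 * d / N.+1%:R.
  by field; rewrite !gt_eqF.
by rewrite ler_pdivrMr// mulrC ler_wpM2l// ltW.
Qed.

(** Outside the event from the maximal inequality, three errors of size at most [l] remain: the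
    average of [h] along the orbit, the boundary terms [D / n], and the difference of the means of
    [b] and [g]. *)
Lemma strong_law_bound (g : R -> R) (e d : R) : 0 < e -> 0 < d ->
  measurable_fun [set: R] g -> P.-integrable setT (EFin \o g) ->
  exists2 A : set (Rinfty R), measurable A & (Pinf A <= d%:E)%E /\
    forall w : Rinfty R, ~ A w -> \forall n \near \oo,
      `|n%:R^-1 * \sum_(k < n) g (w k) - fine (\int[P]_x (g x)%:E)| <= e.
Proof.
move=> e0 d0 mg ig.
pose l := e / 3; have l0 : 0 < l by rewrite divr_gt0.
(* The two parts of [h] each have integral at most [eta], and [eta + eta <= l * d] bounds the
   exceptional event by [d]. The minimum with 1 ensures [eta <= l], used for [|Eb - Eg|]. *)
pose eta := l * Num.min d 1 / 2.
have md0 : 0 < Num.min d 1 by rewrite lt_min d0 ltr01.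
have eta0 : 0 < eta by rewrite divr_gt0// mulr_gt0.
have etal : eta <= l.
  rewrite /eta -mulrA ler_piMr ?(ltW l0)// ler_pdivrMr// mul1r.
  by rewrite (@le_trans _ _ 1) ?ge_min ?lexx ?orbT// ler1n.
have [b [mb [C bC] gb]] := L1_bounded_approx eta0 ig.
have ib := bounded_integrable P mb bC.
have igb : P.-integrable setT (EFin \o (fun x => g x - b x)).
  rewrite (_ : _ \o _ = (EFin \o g) \- (EFin \o b))%E; first exact: integrableB.
  by apply/funext => x /=; rewrite EFinB.
set Eg := fine _; pose Eb := fine (\int[P]_x (b x)%:E)%E.
have EgE : (\int[P]_x (g x)%:E = Eg%:E)%E.
  by rewrite /Eg fineK//; exact: (integrable_fin_num _ ig).
have EbE : (\int[P]_x (b x)%:E = Eb%:E)%E.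
  by rewrite /Eb fineK//; exact: (integrable_fin_num _ ib).
have EbEg : `|Eb - Eg| <= l.
  rewrite distrC -lee_fin (le_trans _ (le_trans gb _)) ?lee_fin//.
  have -> : `|Eg - Eb|%:E = (`|\int[P]_x (g x - b x)%:E|)%E.
    under eq_integral do rewrite EFinB.
    by rewrite integralB//= EgE EbE.
  by apply: le_abse_integral => //; exact: (measurable_int _ igb).
pose phi x := b x - Eb.
have mphi : measurable_fun [set: R] phi by exact: measurable_funB.
have phiC x : `|phi x| <= C + `|Eb| by rewrite (le_trans (ler_normB _ _))// lerD2r.
have Ephi0 : (\int[P]_x (phi x)%:E = 0)%E.
  rewrite /phi; under eq_integral do rewrite EFinB.
  rewrite integralB//=; last exact: finite_measure_integrable_cst.
  rewrite EbE integral_cst// [X in (_ * X)%E](_ : _ = 1%E) ?mule1 ?subee//.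
  exact: probability_setT.
have [N ZN] := weak_law eta0 mphi phiC Ephi0.
pose Z (w : Rinfty R) := N.+1%:R^-1 * \sum_(j < N.+1) phi (w j).
pose h (w : Rinfty R) := `|Z w| + `|g (w 0%N) - b (w 0%N)|.
have mZ : measurable_fun [set: Rinfty R] Z.
  apply: measurable_funM => //; apply: measurable_sum => j.
  by apply: (measurableT_comp mphi); exact: measurable_coord.
have mgb : measurable_fun [set: R] (fun x => `|g x - b x|).
  by apply: measurableT_comp => //; exact: measurable_funB.
have mgb0 : measurable_fun [set: Rinfty R] (fun w => `|g (w 0%N) - b (w 0%N)|).
  by apply: (measurableT_comp mgb); exact: measurable_coord.
have mnZ : measurable_fun [set: Rinfty R] (fun w => `|Z w|).
  exact: measurableT_comp.
have mh : measurable_fun [set: Rinfty R] h by exact: measurable_funD.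
have ih : (\int[Pinf]_w (h w)%:E <= (eta + eta)%:E)%E.
  under eq_integral do rewrite EFinD.
  rewrite ge0_integralD//; last 2 first.
  - exact/measurable_EFinP.
  - exact/measurable_EFinP.
  rewrite EFinD leeD//.
  rewrite (ge0_integral_coord Pinf_prod 0 (g := fun x => `|g x - b x|%:E))//.
  exact/measurable_EFinP.
have [||A mA [PA HA]] := @maximal_inequality _ _ _ Pinf _ (@measurable_shift R)
  (shift_preserving Pinf_prod) h mh _ _ l l0.
- by move=> w; rewrite addr_ge0.
- exact: le_lt_trans ih (ltry _).
exists A => //; split.
  have := le_trans PA ih.
  have -> : eta + eta = l * Num.min d 1 by rewrite /eta; field.
  rewrite EFinM => PAm.
  apply: (@le_trans _ _ (Num.min d 1)%:E); last by rewrite lee_fin ge_min lexx.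
  by rewrite -(@lee_pmul2l _ l%:E)// lte_fin.
move=> w nAw.
(* The boundary error of [sum_moving_average_diff] for [phi], bounded by [C + |Eb|]; it does not
   depend on [n], so [D <= n%:R * l] for large [n]. *)
pose D := N.+1%:R * ((C + `|Eb|) *+ 2).
have D0 : 0 <= D.
  by rewrite mulr_ge0// mulrn_wge0//; exact: le_trans (phiC 0).
exists (Num.truncn (D / l)).+1 => // n /= Dn.
have n0 : 0 < n%:R :> R by rewrite ltr0n (leq_trans _ Dn).
have hn : \sum_(k < n) h (iter k shift w) <= n%:R * l.
  by rewrite leNgt; apply/negP => /HA.
have {}Dn : D <= n%:R * l.
  rewrite -ler_pdivrMr//; apply/ltW/(lt_le_trans (truncnS_gt _)).
  by rewrite ler_nat.
have hE k : h (iter k shift w) = `|N.+1%:R^-1 * \sum_(j < N.+1) phi (w (k + j)%N)|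
    + `|g (w k) - b (w k)|.
  rewrite /h /Z iter_shift addn0; congr (`|_ * _| + _).
  by apply: eq_bigr => j _; rewrite iter_shift.
have Hphi := @sum_moving_average_diff (phi \o w) _ n N (fun k => phiC (w k)).
have -> : n%:R^-1 * \sum_(k < n) g (w k) - Eg =
    n%:R^-1 * (\sum_(k < n) phi (w k) + \sum_(k < n) (g (w k) - b (w k)))
    + (Eb - Eg).
  have E k : phi (w k) + (g (w k) - b (w k)) = g (w k) - Eb.
    by rewrite /phi addrC subrKA.
  rewrite -big_split /=; under [in RHS]eq_bigr do rewrite E.
  rewrite sumrB mulrBr sumr_const card_ord -[X in _ - _ * X]mulr_natl mulrA.
  by rewrite mulVf ?gt_eqF// mul1r addrA subrK.
rewrite (le_trans (ler_normD _ _))//.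
have -> : e = l + l + l by rewrite /l; field.
rewrite lerD// normrM gtr0_norm ?invr_gt0// ler_pdivrMl//.
rewrite mulrDr (le_trans _ (lerD hn Dn))//.
(* The orbit sum of [h] dominates the moving averages of [phi] together with the errors [g - b]; [D]
   pays for replacing [phi] by its moving averages. *)
apply: le_trans (_ : _ <= \sum_(k < n) h (iter k shift w) + D) _; last exact: lerD.
under [in leRHS]eq_bigr do rewrite hE.
rewrite [in leRHS]big_split [leRHS]addrAC (le_trans (ler_normD _ _))// lerD//;
  last exact: ler_norm_sum.
set a := \sum_(k < n) (N.+1%:R^-1 * \sum_(j < N.+1) (phi \o w) (k + j)%N) in Hphi.
have -> : \sum_(k < n) phi (w k) = a + (\sum_(k < n) phi (w k) - a).
  by rewrite addrC subrK.
rewrite (le_trans (ler_normD _ _))// lerD//; first exact: ler_norm_sum.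
by rewrite distrC.
Qed.

(** For each tolerance [m.+1%:R^-1] the failure event lies in events of arbitrarily small
    probability, hence is negligible; countably many tolerances suffice. *)
Lemma strong_law (g : R -> R) :
  measurable_fun [set: R] g -> P.-integrable setT (EFin \o g) ->
  {ae Pinf, forall w : Rinfty R, n%:R^-1 * \sum_(k < n) g (w k) @[n --> \oo] -->
    fine (\int[P]_x (g x)%:E)}.
Proof.
move=> mg ig.
have H m : {ae Pinf, forall w : Rinfty R, \forall n \near \oo,
    `|n%:R^-1 * \sum_(k < n) g (w k) - fine (\int[P]_x (g x)%:E)| <= m.+1%:R^-1}.
  apply: arbitrarily_small_negligible => d d0.
  have m0 : 0 < m.+1%:R^-1 :> R by rewrite invr_gt0.
  have [A mA [PA HA]] := strong_law_bound m0 d0 mg ig.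
  exists A => //; split => // w /= nw; apply: contrapT => nAw.
  by apply: nw; exact: HA.
apply: filterS (ae_foralln H) => w Hw.
apply/cvgrPdistC_le => e e0.
have me : (Num.truncn e^-1).+1%:R^-1 <= e.
  rewrite -[leRHS]invrK lef_pV2 ?posrE ?invr_gt0//.
  exact/ltW/truncnS_gt.
by apply: filterS (Hw (Num.truncn e^-1)) => n /le_trans; apply.
Qed.

End strong_law.

(** * Densities and dense sequences *)

Section density_integration.
Context {R : realType}.
Local Notation leb := (@lebesgue_measure R).

(* [R] and [measurableTypeR R] have the same measurable sets but different
   displays; Lebesgue measure lives on the latter. *)
Let idR : R -> measurableTypeR R := idfun.

#[local] HB.instance Definition _ := @isMeasurableFun.Build _ _ R
  (measurableTypeR R) idR (@measurable_id _ _ setT).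

(** The image of [Q] under [idR] is dominated by Lebesgue measure, and its Radon-Nikodym derivative
    agrees almost everywhere with [q] because both have the same integrals over measurable sets. *)
Lemma density_integral (Q : probability R R) (q : R -> R) (h : R -> \bar R) :
  is_density Q q -> measurable_fun [set: R] h -> (forall x, 0 <= h x)%E ->
  (\int[Q]_x h x = \int[leb]_x (h x * (q x)%:E))%E.
Proof.
move=> [mq q0 Qq] mh h0.
pose Q' := distribution Q idR.
have Q'q A : measurable A -> (Q' A = \int[leb]_(x in A) (q x)%:E)%E.
  exact: Qq.
have mh' : measurable_fun [set: measurableTypeR R] h by exact: mh.
have mq' : measurable_fun [set: measurableTypeR R] (EFin \o q).
  by apply/measurable_EFinP; exact: mq.
have -> : (\int[Q]_x h x = \int[Q']_x h x)%E.
  by rewrite /Q' ge0_integral_distribution.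
have dom : Q' `<< leb.
  apply/null_content_dominatesP => A mA A0; rewrite Q'q//.
  by apply: null_set_integral => //; exact: measurable_funTS.
have qE : ae_eq leb setT (Radon_Nikodym_SigmaFinite.f Q' leb) (EFin \o q).
  apply: integral_ae_eq => //.
  - exact: Radon_Nikodym_SigmaFinite.f_integrable.
  - by move=> E _ mE; rewrite -Radon_Nikodym_SigmaFinite.f_integral//;
    exact: Q'q.
have mf := measurable_int _ (Radon_Nikodym_SigmaFinite.f_integrable dom).
rewrite -(Radon_Nikodym_SigmaFinite.change_of_variables dom h0)//.
apply: ae_eq_integral => //.
- exact: emeasurable_funM.
- exact: emeasurable_funM.
- exact: ae_eqe_mul2l.
Qed.

(** For a nonnegative base the inverse is the real power with exponent [-1]. *)
Lemma measurable_density_inv (P : probability R R) (p : R -> R) :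
  is_density P p -> measurable_fun [set: R] (fun x => (p x)^-1).
Proof.
move=> [mp p0 _]; under eq_fun do rewrite -powR_inv1//.
by apply: (@measurableT_comp _ _ _ _ _ _ (@powR R ^~ (-1))) => //.
Qed.

Lemma density_ratio_integral (Q P : probability R R) (q p h : R -> R) :
  is_density Q q -> is_density P p -> supp q `<=` supp p ->
  measurable_fun [set: R] h -> (forall x, 0 <= h x) ->
  (\int[Q]_x (h x)%:E = \int[P]_x (h x * q x / p x)%:E)%E.
Proof.
move=> dQ dP qp mh h0; have [mq q0 _] := dQ; have [mp p0 _] := dP.
have mhqp : measurable_fun [set: R] (fun x => (h x * q x / p x)%:E).
  apply/measurable_EFinP; apply: measurable_funM; first exact: measurable_funM.
  exact: measurable_density_inv dP.
rewrite (density_integral dQ)//; last exact/measurable_EFinP.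
rewrite (density_integral dP)//; last first.
  by move=> x; rewrite lee_fin divr_ge0// mulr_ge0.
apply: eq_integral => x _; rewrite -!EFinM; congr EFin.
(* Where [p] vanishes so does [q], by the inclusion of supports, and both integrands are 0. *)
have [px0|px] := eqVneq (p x) 0; last by rewrite mulrVK// unitfE.
suff -> : q x = 0 by rewrite !mulr0 !mul0r.
apply/eqP; rewrite eq_le q0 andbT leNgt; apply/negP => /qp.
by rewrite /supp /= px0 ltxx.
Qed.

(** Writing [f = (f + M) - M] reduces the signed case to two nonnegative bounded functions, to which
    [density_ratio_integral] applies. *)
Lemma density_ratio_expectation (Q P : probability R R) (q p f : R -> R)
    (M : R) :
  is_density Q q -> is_density P p -> supp q `<=` supp p ->
  measurable_fun [set: R] f -> (forall x, `|f x| <= M) ->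
  (\int[Q]_x (f x)%:E = \int[P]_x (f x * q x / p x)%:E)%E.
Proof.
move=> dQ dP qp mf fM; have [mq q0 _] := dQ; have [mp p0 _] := dP.
have M0 : 0 <= M by exact: le_trans (fM 0).
have iR (h : R -> R) C : measurable_fun [set: R] h -> (forall x, 0 <= h x) ->
    (forall x, h x <= C) ->
    P.-integrable setT (EFin \o (fun x => h x * q x / p x)).
  move=> mh h0 hC; apply/integrableP; split.
    apply/measurable_EFinP; apply: measurable_funM; first exact: measurable_funM.
    exact: measurable_density_inv dP.
  under eq_integral do
    rewrite /= ger0_norm ?divr_ge0 ?mulr_ge0//.
  rewrite -(density_ratio_integral dQ dP qp mh h0); apply: integrable_lty => //.
  by apply: (bounded_integrable Q mh (C := C)) => x; rewrite ger0_norm.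
have f0 x : 0 <= f x + M.
  by have := fM x; rewrite ler_norml => /andP[? _]; rewrite -lerBlDr sub0r.
have f2 x : f x + M <= M + M by rewrite lerD2r (le_trans (ler_norm _)).
have mfM : measurable_fun [set: R] (fun x => f x + M).
  exact: measurable_funD.
have mM : measurable_fun [set: R] (cst M) by exact: measurable_cst.
transitivity (\int[Q]_x ((f x + M)%:E - (cst M x)%:E))%E.
  by apply: eq_integral => x _; rewrite -EFinB addrK.
rewrite (integralB_EFin _ (f1 := fun x => f x + M) (f2 := cst M))//; last 2 first.
- by apply: (bounded_integrable Q mfM (C := M + M)) => x; rewrite ger0_norm.
- by apply: (bounded_integrable Q mM (C := M)) => x; rewrite ger0_norm.
rewrite (density_ratio_integral dQ dP qp mfM)//.
rewrite (density_ratio_integral dQ dP qp mM)//.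
rewrite -(integralB_EFin _ (f1 := fun x => (f x + M) * q x / p x)
  (f2 := fun x => cst M x * q x / p x))//; last 2 first.
- exact: (iR _ (M + M)).
- exact: (iR _ M).
by apply: eq_integral => x _; rewrite -EFinB -mulrBl -mulrBl addrK.
Qed.

End density_integration.

Section extrema_of_sequences.
Context d (S : measurableType d) (R : realType).

Lemma measurable_ereal_inf_range (D : set S) (u : nat -> S -> \bar R) :
  (forall i, measurable_fun D (u i)) ->
  measurable_fun D (fun x => ereal_inf (range (u ^~ x))).
Proof.
move=> mu; have := measurable_fun_einfs mu 0%N; congr measurable_fun.
apply/funext => x; rewrite /einfs /=; congr ereal_inf.
by apply/seteqP; split => _ [i _ <-]; exists i.
Qed.

Lemma measurable_ereal_sup_range (D : set S) (u : nat -> S -> \bar R) :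
  (forall i, measurable_fun D (u i)) ->
  measurable_fun D (fun x => ereal_sup (range (u ^~ x))).
Proof.
move=> mu; have := measurable_fun_esups mu 0%N; congr measurable_fun.
apply/funext => x; rewrite /esups /=; congr ereal_sup.
by apply/seteqP; split => _ [i _ <-]; exists i.
Qed.

End extrema_of_sequences.

(** * Dense sequences in compact sets *)

Section dense_sequence.
Context {R : realType} {V : normedModType R} (T : set V).

Definition dense_sequence (s : nat -> V) :=
  (forall i, T (s i)) /\
  forall t, T t -> forall e : R, 0 < e -> exists i, `|t - s i| < e.

(** Compactness gives a finite net in [T] for every radius [n.+1%:R^-1]; the sequence lists all
    these nets. *)
Lemma compact_dense_sequence : compact T -> T !=set0 ->
  exists s, dense_sequence s.
Proof.
move=> cT [t0 Tt0].
have H n : {D : {fset V} | (forall t, t \in D -> T t) /\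
    forall t, T t -> exists2 s, s \in D & `|t - s| < n.+1%:R^-1}.
  apply: cid; move: cT; rewrite compact_cover => cT.
  have n0 : 0 < n.+1%:R^-1 :> R by rewrite invr_gt0.
  have [||D DT TD] := cT V T (fun t => ball t n.+1%:R^-1).
  - by move=> t _; exact: ball_open.
  - by move=> t Tt; exists t => //; exact: ballxx.
  exists D; split; first by move=> t /DT /set_mem.
  move=> t /TD[s sD]; rewrite -ball_normE /= distrC => ts.
  by exists s.
(* The index [k] codes a pair: the net [n] and a position [i] in it. Invalid codes and positions
   return [t0], which keeps the sequence inside [T]. *)
pose s k := if choice.unpickle k is Some (n, i) then
  nth t0 (enum_fset (sval (H n))) i else t0.
exists s; split.
  move=> k; rewrite /s; case: (choice.unpickle k) => [[n i]|//].
  have [DT _] := svalP (H n).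
  have [|?] := ltnP i (size (enum_fset (sval (H n)))); last by rewrite nth_default.
  by move=> /(mem_nth t0) /DT.
move=> t Tt e e0.
pose n := Num.truncn e^-1.
have [_ /(_ t Tt)[r rD tr]] := svalP (H n).
exists (choice.pickle (n, index r (enum_fset (sval (H n))))).
rewrite /s choice.pickleK nth_index//; apply: lt_le_trans tr _.
rewrite -[leRHS]invrK lef_pV2 ?posrE ?invr_gt0//.
exact/ltW/truncnS_gt.
Qed.

Variables (s : nat -> V) (s_dense : dense_sequence s).
Variables (phi : V -> R) (phi_cont : {within T, continuous phi}).

(** If [phi t < c], continuity gives [phi (s i) < c] for some [s i] close to [t]; as the ball around
    [t0] is open, [s i] can be taken inside it. The local form serves suprema over balls as well as
    global infima. *)
Lemma dense_sequence_ge (t0 : V) (e : R) (c : R) :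
  (forall i, `|t0 - s i| < e -> c <= phi (s i)) ->
  forall t, T t -> `|t0 - t| < e -> c <= phi t.
Proof.
move=> H t Tt te; rewrite leNgt; apply/negP => ct.
have /(_ t Tt)/cvgrPdist_lt/(_ (c - phi t)) := (subspace_continuousP _ _).1 phi_cont.
rewrite subr_gt0 => /(_ ct); rewrite near_withinE => /nbhs_ballP[r /= r0 Hr].
have [|i] := s_dense.2 t Tt (Num.min r (e - `|t0 - t|)).
  by rewrite lt_min r0 subr_gt0.
rewrite lt_min => /andP[tr te'].
have := Hr (s i); rewrite -ball_normE /= => /(_ tr (s_dense.1 i)).
have : c <= phi (s i).
  apply: H; rewrite -(subrKA t) (le_lt_trans (ler_normD _ _))//.
  by rewrite -ltrBrDl.
rewrite ltr_norml opprB ltrD2l ltrN2 => cphi /andP[phic _].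
by have := lt_le_trans phic cphi; rewrite ltxx.
Qed.

End dense_sequence.

(** * Uniform strong law *)

Section extrema_over_dense_sequence.
Context {R : realType} {V : normedModType R} (T : set V).
Variables (s : nat -> V) (s_dense : dense_sequence T s).
Variables (phi : V -> R) (phi_cont : {within T, continuous phi}).

Lemma ereal_inf_dense :
  ereal_inf [set (phi t)%:E | t in T] = ereal_inf (range (EFin \o phi \o s)).
Proof.
apply/eqP; rewrite eq_le; apply/andP; split.
  apply: le_ereal_inf => _ [i _ <-]; exists (s i) => //; exact: s_dense.1.
apply/le_ereal_inf_tmp => _ [t Tt <-].
set m := ereal_inf _.
have mi i : (m <= (phi (s i))%:E)%E by apply: ereal_inf_lbound; exists i.
case: m mi => [r|/(_ 0%N)|] mi; last by rewrite leNye.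
- rewrite lee_fin; apply: (dense_sequence_ge s_dense phi_cont (t0 := t) (e := 1)).
  + by move=> i _; rewrite -lee_fin.
  + exact: Tt.
  + by rewrite subrr normr0.
- by rewrite leye_eq in mi.
Qed.

End extrema_over_dense_sequence.

Lemma ereal_sup_dense {R : realType} {V : normedModType R} (T : set V)
    (s : nat -> V) (phi : V -> R) :
  dense_sequence T s -> {within T, continuous phi} ->
  ereal_sup [set (phi t)%:E | t in T] = ereal_sup (range (EFin \o phi \o s)).
Proof.
move=> ds cphi.
have cN : {within T, continuous (fun t => - phi t)}.
  apply/subspace_continuousP => t Tt; apply: cvgN.
  exact: (subspace_continuousP _ _).1 cphi t Tt.
have := ereal_inf_dense ds cN.
rewrite [X in ereal_inf X](_ : _ = -%E @` [set (phi t)%:E | t in T]); last first.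
  by rewrite image_comp; apply: eq_imagel.
rewrite [X in _ = ereal_inf X](_ : _ = -%E @` range (EFin \o phi \o s)); last first.
  by rewrite image_comp; apply: eq_imagel.
by rewrite !ereal_infN => /oppe_inj.
Qed.

Section uniform_strong_law.
Context {R : realType} {V : normedModType R}.
Variables (P : probability R R) (Pinf : probability (Rinfty R) R).
Hypothesis Pinf_prod : is_infinite_product P Pinf.
Variables (T : set V) (T_compact : compact T).
Variable g : V -> R -> R.
Hypothesis g_measurable : forall t, T t -> measurable_fun [set: R] (g t).
Hypothesis g_cont : forall x, {within T, continuous (g ^~ x)}.
Variable F : R -> R.
Hypothesis F_integrable : P.-integrable setT (EFin \o F).
Hypothesis g_le : forall t x, T t -> `|g t x| <= F x.

Lemma envelope_integrable t : T t -> P.-integrable setT (EFin \o g t).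
Proof.
move=> Tt; apply: (le_integrable measurableT _ _ F_integrable).
  by apply/measurable_EFinP; exact: g_measurable.
by move=> x _; rewrite /= lee_fin (le_trans (g_le x Tt))// ler_norm.
Qed.

(* [dO] pairs the radius of a ball around [t0] with a bound on the oscillation
   of [g] over that ball. *)
Lemma local_oscillation t0 (e : R) : T t0 -> 0 < e ->
  exists dO : R * (R -> R), [/\ 0 < dO.1, measurable_fun [set: R] dO.2,
    P.-integrable setT (EFin \o dO.2),
    (\int[P]_x (dO.2 x)%:E <= e%:E)%E &
    forall t x, T t -> `|t0 - t| < dO.1 -> `|g t x - g t0 x| <= dO.2 x].
Proof.
move=> Tt0 e0.
have [s ds] : exists s, dense_sequence T s.
  by apply: compact_dense_sequence => //; exists t0.
(* The value 0 outside the ball keeps every term nonnegative, and indexing by the dense sequence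
   makes the supremum [osc n] measurable. *)
pose u (n i : nat) (x : R) : \bar R :=
  (if `|t0 - s i| < n.+1%:R^-1 then `|g (s i) x - g t0 x| else 0)%:E.
pose osc n x := ereal_sup (range (u n ^~ x)).
have mu n i : measurable_fun [set: R] (u n i).
  apply/measurable_EFinP; case: (_ < _); last exact: measurable_cst.
  apply: measurableT_comp => //; apply: measurable_funB; last exact: g_measurable.
  by apply: g_measurable; exact: ds.1.
have mosc n : measurable_fun [set: R] (osc n) by exact: measurable_ereal_sup_range.
have u_ge0 n i x : (0 <= u n i x)%E by rewrite lee_fin; case: ifP.
have osc_ge0 n x : (0 <= osc n x)%E.
  by apply: (le_trans (u_ge0 n 0%N x)); apply: ereal_sup_ubound; exists 0%N.
have F0 x : 0 <= F x by apply: le_trans (g_le x Tt0).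
have osc_le n x : (osc n x <= (F x *+ 2)%:E)%E.
  apply: ge_ereal_sup => _ [i _ <-]; rewrite lee_fin mulr2n.
  case: ifP => _; last exact: addr_ge0.
  by rewrite (le_trans (ler_normB _ _))// lerD// g_le//; exact: ds.1.
have osc_fin n x : osc n x \is a fin_num.
  by rewrite ge0_fin_numE// (le_lt_trans (osc_le n x))// ltry.
have osc_cvg x : osc n x @[n --> \oo] --> 0%E.
  apply/fine_cvgP; split; first exact: nearW.
  apply/cvgrPdist_le => r r0.
  have /(_ t0 Tt0)/cvgrPdist_lt/(_ r r0) :=
    (subspace_continuousP _ _).1 (@g_cont x).
  rewrite near_withinE => /nbhs_ballP[d /= d0 Hd].
  exists (Num.truncn d^-1) => // n /= dn.
  rewrite /= sub0r normrN ger0_norm ?fine_ge0//.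
  rewrite -lee_fin fineK//; apply: ge_ereal_sup => _ [i _ <-].
  rewrite lee_fin; case: ifP => [t0i|_]; last exact: ltW.
  rewrite distrC ltW//; apply: (Hd (s i)); last exact: ds.1.
  rewrite -ball_normE /= (lt_le_trans t0i)//.
  rewrite -[leRHS]invrK lef_pV2 ?posrE ?invr_gt0//.
  by apply/ltW/(lt_le_trans (truncnS_gt _)); rewrite ler_nat ltnS.
have iF2 : P.-integrable setT (fun x => (F x *+ 2)%:E).
  have := integrableZr measurableT 2 F_integrable; apply: eq_integrable => // x _.
  by rewrite /= -EFinM mulr_natr.
have osc_norm x n : setT x -> (`|osc n x| <= (F x *+ 2)%:E)%E.
  by move=> _; rewrite gee0_abs.
(* Continuity at [t0] makes [osc n] tend to 0 pointwise, and [2 F] dominates it. *)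
have [_ _ +] := @dominated_convergence _ _ _ P _ measurableT osc (cst 0%E) _
  mosc (measurable_cst _) (aeW _ (fun x _ => osc_cvg x)) iF2 (aeW _ osc_norm).
rewrite integral0 => osc0.
have e0' : (0 < e%:E)%E by rewrite lte_fin.
have [n _ /(_ n (leqnn n)) Hn] := osc0 _ (open_ereal_lt' e0').
exists (n.+1%:R^-1, fine \o osc n); split => /=.
- by rewrite invr_gt0.
- exact: measurableT_comp.
- apply: (le_integrable measurableT _ _ iF2).
    by apply/measurable_EFinP; exact: measurableT_comp.
  move=> x _; rewrite /= lee_fin !ger0_norm ?fine_ge0 ?mulrn_wge0//.
  by rewrite -lee_fin fineK.
- under eq_integral do rewrite fineK//.
  exact: ltW.
(* The bound holds along the dense sequence by definition of [osc]; negating the distance turns it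
   into a lower bound, which [dense_sequence_ge] extends to all of [T] in the ball. *)
- move=> t x Tt t0t; rewrite -lerN2.
  have cN : {within T, continuous (fun t => - `|g t x - g t0 x|)}.
    apply/subspace_continuousP => r Tr; apply: cvgN; apply: cvg_norm.
    apply: cvgB; last exact: cvg_cst.
    exact: (subspace_continuousP _ _).1 (@g_cont x) r Tr.
  apply: (dense_sequence_ge ds cN (t0 := t0) (e := n.+1%:R^-1)) => // i t0i.
  rewrite lerN2 -lee_fin fineK//; apply: ereal_sup_ubound.
  by exists i => //; rewrite /u t0i.
Qed.

Let Eg t := fine (\int[P]_x (g t x)%:E).

Lemma uniform_strong_law_bound (e : R) : 0 < e ->
  {ae Pinf, forall w : Rinfty R, \forall n \near \oo, forall t, T t ->
    `|n%:R^-1 * \sum_(k < n) g t (w k) - Eg t| <= e}.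
Proof.
(* With [t0] the centre of a ball containing [t], the averages at [t] and [t0] differ by at most
   [EO t0 + r <= r + r]; the law at [t0] and the difference of the means cost [r] each. *)
move=> e0; pose r := e / 4; have r0 : 0 < r by rewrite divr_gt0.
have /choice[dO dOP] t : exists dO : R * (R -> R), T t ->
    [/\ 0 < dO.1, measurable_fun [set: R] dO.2,
    P.-integrable setT (EFin \o dO.2),
    (\int[P]_x (dO.2 x)%:E <= r%:E)%E &
    forall s x, T s -> `|t - s| < dO.1 -> `|g s x - g t x| <= dO.2 x].
  (* The pair outside [T] is a dummy value that makes [choice] applicable. *)
  have [Tt|nTt] := pselect (T t); last by exists (0, cst 0).
  by have [dO HdO] := local_oscillation Tt r0; exists dO.
have [D DT TD] : finite_subset_cover T (fun t => ball t (dO t).1) T.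
- have := T_compact; rewrite compact_cover; apply.
    by move=> t _; exact: ball_open.
  by move=> t Tt; exists t => //; have [d0 _ _ _ _] := dOP t Tt; exact: ballxx.
pose EO t := fine (\int[P]_x ((dO t).2 x)%:E).
have slln : {ae Pinf, forall w : Rinfty R, forall t, t \in D ->
    (n%:R^-1 * \sum_(k < n) g t (w k) @[n --> \oo] --> Eg t) /\
    (n%:R^-1 * \sum_(k < n) (dO t).2 (w k) @[n --> \oo] --> EO t)}.
  apply: filter_bigI => t /DT /set_mem Tt; have [_ mO iO _ _] := dOP t Tt.
  by apply: filterI; apply: (strong_law Pinf_prod) => //;
    [exact: g_measurable|exact: envelope_integrable].
apply: filterS slln => w slln.
have nearD : \forall n \near \oo, forall t, t \in D ->
    `|n%:R^-1 * \sum_(k < n) g t (w k) - Eg t| <= r /\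
    `|n%:R^-1 * \sum_(k < n) (dO t).2 (w k) - EO t| <= r.
  apply: filter_bigI => t.
  move=> /slln[/cvgrPdistC_le/(_ _ r0) H1 /cvgrPdistC_le/(_ _ r0) H2].
  exact: filterI.
apply: filterS nearD => n nearD t Tt.
have [t0 t0D] := TD t Tt; rewrite -ball_normE /= => t0t.
have Tt0 : T t0 by move: t0D => /DT /set_mem.
have [_ mO iO EOr osc] := dOP t0 Tt0.
have [near1 near2] := nearD t0 t0D.
have iEO : (\int[P]_x ((dO t0).2 x)%:E)%E = (EO t0)%:E.
  by rewrite fineK//; exact: (integrable_fin_num _ iO).
have {}EOr : EO t0 <= r by rewrite -lee_fin -iEO.
have avg : `|n%:R^-1 * \sum_(k < n) g t (w k)
            - n%:R^-1 * \sum_(k < n) g t0 (w k)|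
    <= n%:R^-1 * \sum_(k < n) (dO t0).2 (w k).
  rewrite -mulrBr -sumrB normrM ger0_norm ?invr_ge0// ler_wpM2l ?invr_ge0//.
  rewrite (le_trans (ler_norm_sum _ _ _))//; apply: ler_sum => k _.
  exact: osc.
have Ediff : `|Eg t - Eg t0| <= EO t0.
  rewrite -lee_fin -iEO.
  have igt := envelope_integrable Tt; have igt0 := envelope_integrable Tt0.
  have igB : P.-integrable setT (EFin \o (fun x => g t x - g t0 x)).
    rewrite (_ : _ \o _ = (EFin \o g t) \- (EFin \o g t0))%E.
      exact: integrableB.
    by apply/funext => x /=; rewrite EFinB.
  have -> : (`|Eg t - Eg t0|%:E = `|\int[P]_x (g t x - g t0 x)%:E|)%E.
    under eq_integral do rewrite EFinB.
    rewrite integralB//= -abse_EFin EFinB !fineK//.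
      exact: (integrable_fin_num _ igt0).
    exact: (integrable_fin_num _ igt).
  apply: (le_trans (le_abse_integral _ measurableT (measurable_int _ igB))).
  apply: ge0_le_integral => //.
  - by apply: measurableT_comp => //; exact: (measurable_int _ igB).
  - exact/measurable_EFinP.
  - by move=> x _; rewrite lee_fin osc.
rewrite (_ : e = r + r + r + r); last by rewrite /r; field.
move: avg Ediff near1 near2 EOr; rewrite !ler_norml.
set a := _ * \sum_(k < n) g t (w k); set b := _ * \sum_(k < n) g t0 (w k).
set c := _ * \sum_(k < n) _.
move=> /andP[? ?] /andP[? ?] /andP[? ?] /andP[? ?] ?.
by apply/andP; split; lra.
Qed.

Lemma uniform_strong_law :
  {ae Pinf, forall w : Rinfty R, forall e : R, 0 < e ->
    \forall n \near \oo, forall t, T t ->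
    `|n%:R^-1 * \sum_(k < n) g t (w k) - fine (\int[P]_x (g t x)%:E)| <= e}.
Proof.
have H m : 0 < m.+1%:R^-1 :> R by rewrite invr_gt0.
apply: filterS (ae_foralln (fun m => uniform_strong_law_bound (H m))) => w Hw e e0.
apply: filterS (Hw (Num.truncn e^-1)) => n Hn t Tt; apply: le_trans (Hn t Tt) _.
by rewrite -[leRHS]invrK lef_pV2 ?posrE ?invr_gt0//; exact/ltW/truncnS_gt.
Qed.

End uniform_strong_law.

(** * Consistency *)

(** Taking infima is 1-Lipschitz for the uniform distance. The bound on [b], and hence on [a], makes
    both infima finite, so that their difference is a real subtraction. *)
Lemma ereal_inf_dist {R : realType} {V : Type} (T : set V) (a b : V -> R)
    (M e : R) : T !=set0 -> (forall t, T t -> `|b t| <= M) ->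
  (forall t, T t -> `|a t - b t| <= e) ->
  (`|ereal_inf [set (a t)%:E | t in T] - ereal_inf [set (b t)%:E | t in T]|
    <= e%:E)%E.
Proof.
move=> [t0 Tt0] bM ab.
have inf_fin (c : V -> R) N : (forall t, T t -> - N <= c t) ->
    exists r : R, ereal_inf [set (c t)%:E | t in T] = r%:E.
  move=> cN; set m := ereal_inf _.
  have : (m <= (c t0)%:E)%E by apply: ereal_inf_lbound; exists t0.
  have : ((- N)%:E <= m)%E.
    by apply/le_ereal_inf_tmp => _ [t Tt <-]; rewrite lee_fin cN.
  by case: m => [r| |]//; exists r.
have [|r rE] := inf_fin b M; first by move=> t /bM; rewrite ler_norml => /andP[].
have [|q qE] := inf_fin a (M + e).
  move=> t Tt; have := bM t Tt; have := ab t Tt.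
  by rewrite !ler_norml => /andP[? ?] /andP[? ?]; lra.
have inf_le (c c' : V -> R) m m' : ereal_inf [set (c t)%:E | t in T] = m%:E ->
    ereal_inf [set (c' t)%:E | t in T] = m'%:E ->
    (forall t, T t -> c t <= c' t + e) -> m <= m' + e.
  move=> cE c'E cc'; rewrite -lerBlDr -lee_fin -c'E.
  apply/le_ereal_inf_tmp => _ [t Tt <-].
  rewrite lee_fin lerBlDr (le_trans _ (cc' t Tt))// -lee_fin -cE.
  by apply: ereal_inf_lbound; exists t.
rewrite rE qE -EFinB lee_fin ler_norml; apply/andP; split.
  rewrite lerBrDl -lerBrDr opprK; apply: (inf_le b a) => // t /ab.
  by rewrite ler_norml => /andP[? _]; lra.
rewrite lerBlDl; apply: (inf_le a b) => // t /ab.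
by rewrite ler_norml => /andP[_ ?]; lra.
Qed.

Unset Implicit Arguments.

Theorem theorem17 (R : realType) (m : nat) (hm : (0 < m)%N)
    (T : set 'rV[R]_m) (T_nonempty : T !=set0) (T_compact : compact T)
    (Pt : 'rV[R]_m -> probability R R) (pt : 'rV[R]_m -> R -> R)
    (pt_density : forall t, T t -> is_density (Pt t) (pt t))
    (P : probability R R) (p : R -> R) (p_density : is_density P p)
    (supp_incl : forall t, T t -> supp (pt t) `<=` supp p)
    (f : R -> R) (f_measurable : measurable_fun [set: R] f)
    (f_sup_integrable :
      (ereal_sup [set 'E_(Pt t)[(fun x => `|f x|)%R] | t in T] < +oo)%E)
    (ft : 'rV[R]_m -> R -> R)
    (ft_measurable : forall t, T t -> measurable_fun [set: R] (ft t))
    (ft_def : forall t, T t -> forall x, supp p x ->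
      ft t x = f x * pt t x / p x)
    (Pinf : probability (Rinfty R) R) (Pinf_prod : is_infinite_product P Pinf)
    (To : set 'rV[R]_m) (To_open : open To) (T_sub_To : T `<=` To)
    (pTo : R * 'rV[R]_m -> R)
    (pTo_measurable : borel_measurable_on ([set: R] `*` To) pTo)
    (pTo_ext : forall x t, T t -> pTo (x, t) = pt t x)
    (pTo_C1 : continuously_differentiable_on ([set: R] `*` To) pTo)
    (sup_integrable :
      (\int[@lebesgue_measure R]_x ereal_sup [set (pt t x)%:E | t in T]
        < +oo)%E)
    (f_bounded : exists M : R, forall x, `|f x| <= M) :
  strongly_consistent Pinf (importance_estimator T ft)
    (lower_expectation T Pt f).
Proof.
set leb := @lebesgue_measure R.
have [M fM] := f_bounded.
have M0 : 0 <= M by exact: le_trans (fM 0).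
have [mp p0 _] := p_density.
have mp1 := measurable_density_inv p_density.
have [s ds] := compact_dense_sequence T_compact T_nonempty.
have pt_ge0 t x : T t -> 0 <= pt t x by move=> /pt_density[_ + _]; exact.
have pt_meas t : T t -> measurable_fun [set: R] (pt t) by move=> /pt_density[].
(* Differentiability of [pTo] at [(x, t)] gives joint continuity there, which is restricted to the
   slice of fixed [x] and then to [T], where [pTo] is [pt]. *)
have pt_cont x : {within T, continuous (fun t => pt t x)}.
  apply/subspace_continuousP => t Tt.
  have cpTo : {for (x, t), continuous pTo}.
    apply: differentiable_continuous; apply: pTo_C1.1.
    by split => //; exact: T_sub_To.
  have pTo_cvg : pTo (x, r) @[r --> within T (nbhs t)] --> pt t x.
    rewrite -pTo_ext//.
    have xr : (x, r) @[r --> within T (nbhs t)] --> (x, t).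
      exact: (@cvg_pair _ _ _ _ (nbhs x) (nbhs t) _ _ _ (cst x) id (cvg_cst x)
        (cvg_within _)).
    exact: cvg_comp xr cpTo.
  apply: cvg_trans pTo_cvg; apply: near_eq_cvg; rewrite near_withinE.
  apply: nearW => r Tr.
  by rewrite pTo_ext.
(* Outside of [supp p], [g t x] is [0] because [_ / 0 = 0]. *)
pose g t x := f x * pt t x / p x.
have g_meas t : T t -> measurable_fun [set: R] (g t).
  by move=> Tt; do 2 apply: measurable_funM => //; exact: pt_meas.
have g_cont x : {within T, continuous (g ^~ x)}.
  apply/subspace_continuousP => t Tt; apply: cvgM; last exact: cvg_cst.
  apply: cvgM; first exact: cvg_cst.
  exact: (subspace_continuousP _ _).1 (pt_cont x) t Tt.
pose S x := ereal_sup [set (pt t x)%:E | t in T].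
have ptS t x : T t -> ((pt t x)%:E <= S x)%E.
  by move=> Tt; apply: ereal_sup_ubound; exists t.
have S_ge0 x : (0 <= S x)%E.
  have [t Tt] := T_nonempty; apply: le_trans (ptS t x Tt).
  by rewrite lee_fin pt_ge0.
have S_fin x : S x \is a fin_num.
  rewrite ge0_fin_numE//.
  have /compact_bounded[N [_ HN]] := continuous_compact (pt_cont x) T_compact.
  apply: (@le_lt_trans _ _ (N + 1)%:E); last exact: ltry.
  apply: ge_ereal_sup => _ [t Tt <-]; rewrite lee_fin (le_trans (ler_norm _))//.
  by apply: HN; [rewrite ltrDl|exists t].
have mS : measurable_fun [set: R] S.
  rewrite (_ : S = fun x => ereal_sup (range (fun i => (pt (s i) x)%:E))).
    apply: measurable_ereal_sup_range => i; apply/measurable_EFinP.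
    by apply: pt_meas; exact: ds.1.
  by apply/funext => x; rewrite /S (ereal_sup_dense ds (pt_cont x)).
(* The envelope of the family [g]. Integrating it against [P] cancels [p], so its integral is at
   most [M] times the Lebesgue integral of [S]. *)
pose F x := M * fine (S x) / p x.
have F_ge0 x : 0 <= F x by rewrite divr_ge0// mulr_ge0// fine_ge0.
have mF : measurable_fun [set: R] F.
  by do 2 apply: measurable_funM => //; exact: measurableT_comp.
have iF : P.-integrable setT (EFin \o F).
  apply/integrableP; split; first exact/measurable_EFinP.
  under eq_integral do rewrite /= ger0_norm//.
  rewrite (density_integral p_density)//; last exact/measurable_EFinP.
  apply: (@le_lt_trans _ _ (\int[leb]_x (M%:E * S x))%E).
    apply: ge0_le_integral => //.
    - by move=> x _; rewrite mule_ge0// lee_fin.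
    - by apply: emeasurable_funM; apply/measurable_EFinP.
    - by apply: emeasurable_funM => //; exact: mS.
    - move=> x _; rewrite -(fineK (S_fin x)) -!EFinM lee_fin /F.
      have [px0|px] := eqVneq (p x) 0; last by rewrite mulrVK// unitfE.
      by rewrite px0 mulr0 mulr_ge0// fine_ge0.
  rewrite ge0_integralZl//.
  by rewrite lte_mul_pinfty.
have gF t x : T t -> `|g t x| <= F x.
  move=> Tt; rewrite /g /F !normrM (ger0_norm (pt_ge0 t x Tt)).
  rewrite (@ger0_norm _ (p x)^-1) ?invr_ge0//.
  rewrite ler_wpM2r ?invr_ge0// ler_pM ?pt_ge0//.
  by rewrite -lee_fin fineK// ptS.
pose Eg t := fine (\int[P]_x (g t x)%:E).
have EgE t : T t -> ('E_(Pt t)[f] = (Eg t)%:E)%E.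
  move=> Tt; rewrite unlock /Eg fineK; last first.
    exact: (integrable_fin_num _ (envelope_integrable g_meas iF gF Tt)).
  exact: (density_ratio_expectation (pt_density t Tt) p_density
    (supp_incl t Tt) f_measurable fM).
have Eg_le t : T t -> `|Eg t| <= M.
  move=> Tt; rewrite -lee_fin -abse_EFin -EgE// unlock.
  have ift := bounded_integrable (Pt t) f_measurable fM.
  apply: le_trans (le_abse_integral _ measurableT (measurable_int _ ift)) _.
  apply: (@le_trans _ _ (\int[Pt t]_x (cst M%:E x))%E).
    apply: ge0_le_integral => //.
    - by apply: measurableT_comp => //; exact: (measurable_int _ ift).
    - by move=> x _; rewrite lee_fin.
  rewrite integral_cst// [X in (_ * X)%E](_ : _ = 1%E) ?mule1//.
  exact: probability_setT.
set theta := lower_expectation T Pt f.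
have thetaE : theta = ereal_inf [set (Eg t)%:E | t in T].
  by rewrite /theta /lower_expectation; congr ereal_inf; apply: eq_imagel => t /EgE.
pose avg n t (w : Rinfty R) := n%:R^-1 * \sum_(k < n) g t (w k).
pose Om : set (Rinfty R) := [set w | forall k, supp p (w k)].
have estE n w : Om w ->
    importance_estimator T ft n w = ereal_inf [set (avg n t w)%:E | t in T].
  move=> Omw; congr ereal_inf; apply: eq_imagel => t Tt; congr (_ * _)%:E.
  by apply: eq_bigr => k _; exact: ft_def.
have msupp : measurable (supp p).
  rewrite (_ : supp p = setT `&` p @^-1` `]0, +oo[).
    by apply: mp => //; exact: measurable_itv.
  by rewrite setTI; apply/seteqP; split => x /=; rewrite /supp /= in_itv/= andbT.
have mOm : measurable Om.
  rewrite (_ : Om = \bigcap_k ((fun w : Rinfty R => w k) @^-1` supp p)).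
    apply: bigcapT_measurable => k; rewrite -[X in measurable X]setTI.
    exact: measurable_coord.
  by apply/seteqP; split => w /= H k; [move=> _|]; exact: H.
have aeOm : {ae Pinf, forall w, Om w}.
  suff : {ae Pinf, forall w k, supp p (w k)} by [].
  apply: ae_foralln => k.
  exists ((fun w : Rinfty R => w k) @^-1` ~` supp p); split => //.
    rewrite -[X in measurable X]setTI.
    by apply: measurable_coord => //; exact: measurableC.
  transitivity (P (~` supp p)).
    by apply: (coord_probability Pinf_prod); exact: measurableC.
  have [_ _ ->] := p_density; last exact: measurableC.
  apply: integral0_eq => x /= /negP; rewrite -leNgt => px.
  by apply/eqP; rewrite eqe eq_le px p0.
(* Off [Om] nothing is known about the values of [ft], and [+oo] dominates the error there whatever
   it is; minimality survives because [Om] has full probability. *)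
pose H n w :=
  if w \in Om then `|importance_estimator T ft n w - theta|%E else +oo%E.
have H_abs n w : Om w -> H n w = `|importance_estimator T ft n w - theta|%E.
  by move=> Omw; rewrite /H mem_set.
exists H; split.
  move=> n; split.
  - rewrite (_ : H n = fun w => if w \in Om then
        `|ereal_inf (range (fun i => (avg n (s i) w)%:E)) - theta|%E else +oo%E).
      apply: measurable_fun_ifT.
      + by apply: (measurable_fun_bool true); rewrite setTI preimage_mem_true.
      + apply: measurableT_comp => //; apply: emeasurable_funB => //.
        apply: measurable_ereal_inf_range => i; apply/measurable_EFinP.
        apply: measurable_funM => //; apply: measurable_sum => k.
        apply: (@measurableT_comp _ _ _ _ _ _ (g (s i))); last exact: measurable_coord.
        by apply: g_meas; exact: ds.1.
      + exact: measurable_cst.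
    apply/funext => w; rewrite /H; case: ifP => // /set_mem Omw.
    rewrite estE// (ereal_inf_dense ds (phi := fun t => avg n t w))//.
    apply/subspace_continuousP => t Tt; apply: cvgM; first exact: cvg_cst.
    apply: cvg_big => // [|k _]; first exact: add_continuous.
    exact: (subspace_continuousP _ _).1 (g_cont (w k)) t Tt.
  - by move=> w; rewrite /H; case: ifP => // _; rewrite leey.
  - move=> h mh hh; apply: filterS aeOm => w Omw.
    by rewrite H_abs.
have slln := uniform_strong_law Pinf_prod T_compact g_meas g_cont iF gF.
apply: filterS2 aeOm slln => w Omw slln.
have Hle e : 0 < e -> \forall n \near \oo, (H n w <= e%:E)%E.
  move=> /slln; apply: filterS => n Hn.
  by rewrite H_abs// estE// thetaE; apply: (ereal_inf_dist T_nonempty Eg_le Hn).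
have H0 n : (0 <= H n w)%E by rewrite H_abs.
(* The bound with tolerance 1 gives eventual finiteness, after which convergence is checked in the
   reals. *)
apply/fine_cvgP; split.
  apply: filterS (Hle 1 ltr01) => n Hn.
  by rewrite ge0_fin_numE// (le_lt_trans Hn)// ltry.
apply/cvgrPdist_le => e e0.
apply: filterS (Hle e e0) => n Hn /=.
rewrite sub0r normrN ger0_norm ?fine_ge0//.
by rewrite -lee_fin fineK// ge0_fin_numE// (le_lt_trans Hn)// ltry.
Qed.
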